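(* Let $m>1$, $\chi>0$, and let $p\ge2$ be an integer. If $\alpha\ge0$, then any critical point of $\mathcal F^p_{m,\alpha}$ in $\mathcal R^p$ is a global minimizer of $\mathcal F^p_{m,\alpha}$ on $\mathcal R^p$. In addition, when $\chi=C_p$, there exists a minimizer of $\mathcal F^p_m$ on $\mathcal R^p$, and it is unique up to dilation (i.e. any two minimizers $V,V'$ satisfy $V'=\lambda V$ for some $\lambda>0$).
   Context: $\mathcal R^p=\{X\in\mathbb R^p: X_1<\dots<X_p,\ \sum_iX_i=0\}$. $\mathcal F^p_{m,\alpha}(X)=\frac1{m-1}\sum_{i=1}^{p-1}(X_{i+1}-X_i)^{1-m}-\frac{\chi}{m-1}\sum_{1\le i\ne j\le p}|X_i-X_j|^{1-m}+\alpha\frac{|X|^2}{2}$, $\mathcal F^p_m=\mathcal F^p_{m,0}$. $C_p$ is defined by $\frac1{C_p}=\max_{X\in\mathcal R^p}\frac{\sum_{1\le i\ne j\le p}|X_j-X_i|^{1-m}}{\sum_{i=1}^{p-1}(X_{i+1}-X_i)^{1-m}}$. A critical point is a point of $\mathcal R^p$ where the Euclidean gradient vanishes. *)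

(* Defs.v *)
From HB Require Import structures.
From mathcomp Require Import all_boot all_order all_algebra.
From mathcomp Require Import all_classical all_reals all_analysis.
Set Implicit Arguments. Unset Strict Implicit. Unset Printing Implicit Defensive.
Import Order.TTheory GRing.Theory Num.Theory.
Import numFieldNormedType.Exports.
Local Open Scope classical_set_scope.
Local Open Scope ring_scope.

(* Points X = (X_1,...,X_p) of R^p are functions 'I_p -> R (index i stands for X_{i+1}). *)

Definition Rp {R : realType} (p : nat) : set ('I_p -> R) :=
  [set X | (forall i j : 'I_p, (i < j)%N -> X i < X j) /\ \sum_(i < p) X i = 0].

Definition consec_sum {R : realType} (p : nat) (m : R) (X : 'I_p -> R) : R :=
  \sum_(i < p) \sum_(j < p | val j == (val i).+1) powR (X j - X i) (1 - m).

Definition pair_sum {R : realType} (p : nat) (m : R) (X : 'I_p -> R) : R :=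
  \sum_(i < p) \sum_(j < p | i != j) powR `|X i - X j| (1 - m).

Definition sqnorm {R : realType} (p : nat) (X : 'I_p -> R) : R :=
  \sum_(i < p) X i ^+ 2.

Definition Fma {R : realType} (p : nat) (m chi alpha : R) (X : 'I_p -> R) : R :=
  (m - 1)^-1 * consec_sum m X - chi / (m - 1) * pair_sum m X
  + alpha * sqnorm X / 2.

Definition Fm {R : realType} (p : nat) (m chi : R) (X : 'I_p -> R) : R :=
  Fma m chi 0 X.

(* C_p defined by 1/C_p = max_{X in R^p} pair_sum / consec_sum (max taken as sup). *)
Definition Cp {R : realType} (p : nat) (m : R) : R :=
  (sup [set pair_sum m X / consec_sum m X | X in @Rp R p])^-1.

Definition ebasis {R : realType} (p : nat) (i : 'I_p) : 'I_p -> R :=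
  fun k => if k == i then 1 else 0.

(* X is a critical point of F: X in R^p and the Euclidean gradient of F at X
   vanishes, i.e. every partial derivative exists and equals 0. *)
Definition critical_point {R : realType} (p : nat) (F : ('I_p -> R) -> R)
  (X : 'I_p -> R) : Prop :=
  Rp X /\ forall i : 'I_p,
    is_derive (0 : R) (1 : R) (fun t : R => F (fun k => X k + t * ebasis i k)) 0.

Definition minimizer {R : realType} (p : nat) (F : ('I_p -> R) -> R)
  (V : 'I_p -> R) : Prop :=
  Rp V /\ forall X, Rp X -> F V <= F X.

(* Main.v *)
(* Let d_k be the gaps of a critical point V and e_k those of a competitor X, and
   test the Euler-Lagrange equation of V against the direction h whose gaps are
   d_k (e_k / d_k)^(1-m). The nearest-neighbour terms then give exactly the
   nearest-neighbour sum of X, Jensen's inequality for u^(1-m) on each interval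
   [V_i, V_j] bounds the pair terms below by the pair sum of X, and Chebyshev's
   inequality handles the confinement. At alpha = 0, equality forces all the
   ratios e_k / d_k to agree, which gives uniqueness up to dilation.

   For existence, the ratio pair sum / consecutive sum attains its maximum S_n
   over configurations with n gaps, by induction on n. A remote extra point gives
   S_n < S_(n+1), because S_n <= 2n while that point brings about 2(n+1) times
   its own nearest-neighbour term. If one gap is at least M times another,
   cutting the configuration at that gap bounds the ratio by S_n + O(M^(1-m)), so
   the maximum over n+1 gaps may be sought on the compact set of gaps in [1, M]. *)

Require Import Defs.
From HB Require Import structures.
From mathcomp Require Import all_boot all_order all_algebra.
From mathcomp Require Import all_classical all_reals all_analysis.
From mathcomp Require Import ring lra.
Import Order.TTheory GRing.Theory Num.Theory.
Import numFieldNormedType.Exports.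
Local Open Scope classical_set_scope.
Local Open Scope ring_scope.

Section Gaps.
Set Implicit Arguments. Unset Strict Implicit. Unset Printing Implicit Defensive.
Context {R : realType}.
Implicit Types (m u s c : R) (g d e : nat -> R) (n k r : nat).

(** * Gaps and Jensen's inequality *)

Lemma gt0_ler_powR1B m u s : 1 < m -> 0 < u -> u <= s ->
  s `^ (1 - m) <= u `^ (1 - m).
Proof.
move=> m1 u0 us; have s0 := lt_le_trans u0 us.
rewrite -(opprB m 1) !powRN lef_pV2 ?posrE ?powR_gt0//.
by rewrite ge0_ler_powR ?nnegrE ?(ltW u0) ?(ltW s0)// subr_ge0 ltW.
Qed.

(** The left side is the tangent at 1 to the strictly convex function [u^(1-m)]. Strictness comes
    from [exp x > 1 + x] at the nonzero point [x = (1 - m) ln u], followed by [ln u <= u - 1]. *)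
Lemma powR_tangent1_lt m u : 1 < m -> 0 < u -> u != 1 ->
  m - (m - 1) * u < u `^ (1 - m).
Proof.
move=> m1 u0 u1.
have lnu0 : (1 - m) * ln u != 0 by rewrite mulf_neq0 ?ln_eq0// subr_eq0 lt_eqF.
rewrite [ltRHS]/powR gt_eqF//; apply: le_lt_trans (expR_gt1Dx lnu0).
have lnu : ln u <= u - 1.
  rewrite -[X in ln X](subrKC 1 u) le_ln1Dx//; lra.
rewrite -subr_ge0.
have : 0 <= (m - 1) * (u - 1 - ln u) by rewrite mulr_ge0// subr_ge0 // ltW.
by congr (0 <= _); ring.
Qed.

Lemma powR_tangent1 m u : 1 < m -> 0 < u -> m - (m - 1) * u <= u `^ (1 - m).
Proof.
move=> m1 u0; have [->|u1] := eqVneq u 1; last exact/ltW/powR_tangent1_lt.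
by rewrite powR1 mulr1 subKr.
Qed.

(** The distance between points [i] and [j]. Gaps are sequences on all of [nat], so that truncating
    or shifting a configuration does not change its type. *)
Definition gapsum g i j := \sum_(i <= k < j) g k.

Definition consec_gaps m n g := \sum_(k < n) g k `^ (1 - m).

Definition pair_gaps m n g :=
  \sum_(j < n.+1) \sum_(i < j) gapsum g i j `^ (1 - m).

(* The variation [V + t h] of gaps [d] against which the Euler-Lagrange equation
   is tested has [h]-gaps [d_k u_k^(1-m)], where [u_k = e_k / d_k]. *)
Definition test_gaps m d e : nat -> R := fun k => d k * (e k / d k) `^ (1 - m).

Lemma gapsum_gt0 g i j : (forall k, 0 < g k) -> (i < j)%N -> 0 < gapsum g i j.
Proof.
move=> g0 ij; rewrite /gapsum big_ltn// ltr_pwDl//.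
by rewrite sumr_ge0// => k _; exact/ltW.
Qed.

Lemma gapsum_cat g i k j : (i <= k)%N -> (k <= j)%N ->
  gapsum g i k + gapsum g k j = gapsum g i j.
Proof. by move=> ik kj; rewrite /gapsum -(big_cat_nat ik kj). Qed.

Lemma gapsumZ c g i j : gapsum (fun k => c * g k) i j = c * gapsum g i j.
Proof. by rewrite /gapsum mulr_sumr. Qed.

Lemma gapsumD g e i j :
  gapsum (fun k => g k + e k) i j = gapsum g i j + gapsum e i j.
Proof. by rewrite /gapsum big_split. Qed.

Lemma gapsum_shift g a i j :
  gapsum (fun k => g (a + k)%N) i j = gapsum g (a + i) (a + j).
Proof. by rewrite /gapsum /index_iota subnDl iotaDl big_map. Qed.

(** The tangent inequality at [u = e_k / (s d_k)], scaled by [d_k s^(1-m)]. The point [s] stays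
    free: Jensen takes the mean ratio, the confinement term takes [s = 1]. *)
Lemma test_gaps_tangent m d e s k : 1 < m -> 0 < s -> 0 < d k -> 0 < e k ->
  s `^ (1 - m) * (m * d k - (m - 1) * (e k / s)) <= test_gaps m d e k
    ?= iff (e k == s * d k).
Proof.
move=> m1 s0 dk0 ek0.
have sp : 0 < s `^ (1 - m) by rewrite powR_gt0.
have dk : d k != 0 by rewrite gt_eqF.
have sn : s != 0 by rewrite gt_eqF.
set t := e k / d k / s.
have t0 : 0 < t by rewrite !divr_gt0.
have -> : test_gaps m d e k = s `^ (1 - m) * (d k * t `^ (1 - m)).
  rewrite /test_gaps mulrCA -powRM ?(ltW t0) ?(ltW s0)//.
  by rewrite /t mulrCA mulfV// mulr1.
have -> : m * d k - (m - 1) * (e k / s) = d k * (m - (m - 1) * t).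
  by rewrite /t; field; rewrite dk sn.
have et : (e k == s * d k) = (t == 1).
  rewrite -[RHS](inj_eq (mulIf sn)) divfK// mul1r.
  by rewrite -[RHS](inj_eq (mulIf dk)) divfK.
rewrite et; have [t1|t1] := eqVneq t 1.
  apply/leifP; by rewrite t1 powR1 mulr1 subKr mulr1.
by apply/leifP; rewrite ltr_pM2l// ltr_pM2l// powR_tangent1_lt.
Qed.

(* Jensen's inequality: sum the tangent inequality at the mean ratio [s]. *)
Lemma gapsum_test_gaps m d e i j : 1 < m -> (forall k, 0 < d k) ->
  (forall k, 0 < e k) -> (i < j)%N ->
  gapsum d i j `^ m * gapsum e i j `^ (1 - m) <= gapsum (test_gaps m d e) i j
    ?= iff [forall k : 'I_j, (i <= k)%N ==>
             (e k == gapsum e i j / gapsum d i j * d k)].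
Proof.
move=> m1 d0 e0 ij.
have D0 := gapsum_gt0 d0 ij; have E0 := gapsum_gt0 e0 ij.
set D := gapsum d i j in D0 *; set E := gapsum e i j in E0 *.
pose s := E / D; have s0 : 0 < s by rewrite divr_gt0.
(* Since [E / s = D], the tangents at [s] sum to [s^(1-m) D], which is [D^m E^(1-m)]. *)
have -> : D `^ m * E `^ (1 - m) =
    gapsum (fun k => s `^ (1 - m) * (m * d k - (m - 1) * (e k / s))) i j.
  rewrite gapsumZ.
  have -> : gapsum (fun k => m * d k - (m - 1) * (e k / s)) i j =
      m * D + (1 - m) / s * E.
    rewrite -!gapsumZ -gapsumD; apply: eq_bigr => k _.
    by rewrite -mulNr opprB mulrA (mulrAC (1 - m)).
  have -> : m * D + (1 - m) / s * E = D.
    rewrite /s; field; by rewrite !gt_eqF.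
  have {1}-> : E = s * D by rewrite /s divfK// gt_eqF.
  rewrite powRM ?(ltW s0) ?(ltW D0)// mulrCA -powRD ?subrKC ?oner_eq0//.
    by rewrite powRr1 ?(ltW D0).
rewrite /gapsum !big_geq_mkord/=.
apply: leif_sum => k _.
exact: test_gaps_tangent.
Qed.

(** * The maximal ratio is attained *)

Lemma consec_gapsS m n g :
  consec_gaps m n.+1 g = consec_gaps m n g + g n `^ (1 - m).
Proof. by rewrite /consec_gaps big_ord_recr. Qed.

Lemma pair_gapsS m n g : pair_gaps m n.+1 g =
  pair_gaps m n g + \sum_(i < n.+1) gapsum g i n.+1 `^ (1 - m).
Proof. by rewrite /pair_gaps big_ord_recr. Qed.

Lemma pair_gaps0 m g : pair_gaps m 0 g = 0.
Proof. by rewrite /pair_gaps big_ord1 big_ord0. Qed.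

Lemma eq_gapsum n g e i j : (forall k, (k < n)%N -> g k = e k) -> (j <= n)%N ->
  gapsum g i j = gapsum e i j.
Proof.
move=> ge jn; rewrite /gapsum !big_nat; apply: eq_bigr => k /andP[_ kj].
by rewrite ge// (leq_trans kj).
Qed.

Lemma eq_consec_gaps m n g e : (forall k, (k < n)%N -> g k = e k) ->
  consec_gaps m n g = consec_gaps m n e.
Proof. by move=> ge; apply: eq_bigr => k _; rewrite ge. Qed.

Lemma eq_pair_gaps m n g e : (forall k, (k < n)%N -> g k = e k) ->
  pair_gaps m n g = pair_gaps m n e.
Proof.
move=> ge; apply: eq_bigr => j _; apply: eq_bigr => i _.
by rewrite (eq_gapsum _ ge)// -ltnS.
Qed.

Lemma consec_gapsZ m c n g : 0 < c -> (forall k, 0 < g k) ->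
  consec_gaps m n (fun k => c * g k) = c `^ (1 - m) * consec_gaps m n g.
Proof.
move=> c0 g0; rewrite /consec_gaps mulr_sumr; apply: eq_bigr => k _.
by rewrite powRM// ltW.
Qed.

Lemma pair_gapsZ m c n g : 0 < c -> (forall k, 0 < g k) ->
  pair_gaps m n (fun k => c * g k) = c `^ (1 - m) * pair_gaps m n g.
Proof.
move=> c0 g0; rewrite /pair_gaps mulr_sumr; apply: eq_bigr => j _.
rewrite mulr_sumr; apply: eq_bigr => i _.
by rewrite gapsumZ powRM// ltW// gapsum_gt0.
Qed.

Lemma consec_gaps_ge0 m n g : 0 <= consec_gaps m n g.
Proof. by apply: sumr_ge0 => k _; exact: powR_ge0. Qed.

Lemma consec_gaps_gt0 m n g : (0 < n)%N -> (forall k, 0 < g k) ->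
  0 < consec_gaps m n g.
Proof.
case: n => // n _ g0; rewrite consec_gapsS ltr_wpDl ?consec_gaps_ge0//.
exact: powR_gt0.
Qed.

Lemma gapsum_ge g i j k : (forall k, 0 < g k) -> (i <= k < j)%N ->
  g k <= gapsum g i j.
Proof.
move=> g0 /andP[ik kj].
rewrite /gapsum (big_cat_nat ik (ltnW kj))/= [X in _ + X]big_ltn//.
rewrite addrCA lerDl addr_ge0// sumr_ge0// => ? _; exact: ltW.
Qed.

Lemma powR_gapsum_le m g i j k : 1 < m -> (forall k, 0 < g k) ->
  (i <= k < j)%N -> gapsum g i j `^ (1 - m) <= g k `^ (1 - m).
Proof. by move=> m1 g0 ikj; apply: gt0_ler_powR1B => //; exact: gapsum_ge. Qed.

(** A new last point is at least its own gap away from each of the [n.+1] earlier points, so it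
    brings at most [n.+1] times its nearest-neighbour term. *)
Lemma pair_gaps_le m n g : 1 < m -> (forall k, 0 < g k) ->
  pair_gaps m n g <= n%:R * consec_gaps m n g.
Proof.
move=> m1 g0; elim: n => [|n IH]; first by rewrite pair_gaps0 mul0r.
rewrite pair_gapsS mulrSr mulrDl mul1r lerD//.
  by rewrite (le_trans IH)// ler_wpM2l// consec_gapsS lerDl powR_ge0.
by apply: ler_sum => i _; apply: powR_gapsum_le => //; rewrite leqnn /=.
Qed.

(** Removing gap [k] leaves [k.+1] points on the left and [r.+1] on the right. Every cross pair
    spans gap [k], so it contributes at most [g_k^(1-m)]. *)
Lemma pair_gaps_split m k r g : 1 < m -> (forall k, 0 < g k) ->
  pair_gaps m (k.+1 + r) g <= pair_gaps m k g
    + pair_gaps m r (fun i => g (k.+1 + i)%N)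
    + k.+1%:R * r.+1%:R * g k `^ (1 - m).
Proof.
move=> m1 g0; elim: r => [|r IH].
  rewrite addn0 pair_gapsS pair_gaps0 addr0 mulr1 lerD2l.
  rewrite mulr_natl -[X in _ *+ X](card_ord k.+1) -sumr_const.
  apply: ler_sum => i _; apply: powR_gapsum_le => //.
  by rewrite leqnn -ltnS ltn_ord.
rewrite addnS pair_gapsS [pair_gaps m r.+1 _]pair_gapsS -addnS.
rewrite (@big_split_ord _ _ _ k.+1 r.+1)/=.
have -> : \sum_(i < r.+1) gapsum g (k.+1 + i) (k.+1 + r.+1) `^ (1 - m) =
    \sum_(i < r.+1) gapsum (fun i => g (k.+1 + i)%N) i r.+1 `^ (1 - m).
  by apply: eq_bigr => i _; rewrite gapsum_shift.
set A := pair_gaps m k g in IH *; set B := pair_gaps m r _ in IH *.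
set S := \sum_(i < r.+1) _ `^ _.
have : \sum_(i < k.+1) gapsum g i (k.+1 + r.+1) `^ (1 - m)
    <= k.+1%:R * g k `^ (1 - m).
  rewrite mulr_natl -[X in _ *+ X](card_ord k.+1) -sumr_const.
  apply: ler_sum => i _; apply: powR_gapsum_le => //.
  by rewrite -ltnS ltn_ord addSn ltnS leq_addr.
rewrite (mulrSr _ r.+1) mulrDr mulr1 mulrDl.
move: IH; set T := _ * g k `^ _; set U := _ * g k `^ _.
lra.
Qed.

Lemma consec_gaps_split m k r g : consec_gaps m (k.+1 + r) g =
  consec_gaps m k g + g k `^ (1 - m)
    + consec_gaps m r (fun i => g (k.+1 + i)%N).
Proof.
by rewrite /consec_gaps (@big_split_ord _ _ _ k.+1 r)/= big_ord_recr.
Qed.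

(** * Continuity in the gaps and the maximum over a box *)

Lemma continuous_powR_gt0 (a x : R) : 0 < x ->
  {for x, continuous (fun y : R => y `^ a)}.
Proof.
move=> x0; apply: differentiable_continuous; apply/derivable1_diffP.
by apply: derivable_powR; rewrite in_itv/= x0.
Qed.

Lemma continuous_sumr (T : topologicalType) (I : Type) (r : seq I)
    (f : I -> T -> R) x : (forall i, {for x, continuous (f i)}) ->
  {for x, continuous (fun y => \sum_(i <- r) f i y)}.
Proof.
by move=> fc; apply: cvg_big => [|i _]; [exact: add_continuous|exact: fc].
Qed.

(** Row vectors carry the topology used for compactness. The default value 1 keeps all gaps positive
    and inside [[1, M]]. *)
Definition row_gaps n (v : 'rV[R]_n) : nat -> R :=
  fun k => if insub k is Some i then v ord0 i else 1.

Lemma row_gapsK n g k : (k < n)%N ->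
  row_gaps (\row_(i < n) g i) k = g k.
Proof. by move=> kn; rewrite /row_gaps insubT mxE. Qed.

Lemma continuous_row_gaps n k : continuous (@row_gaps n ^~ k).
Proof.
rewrite /row_gaps; case: insubP => [i _ _|_]; first exact: coord_continuous.
by move=> ?; exact: cst_continuous.
Qed.

Lemma continuous_gapsum_row n i j :
  continuous (fun v : 'rV[R]_n => gapsum (row_gaps v) i j).
Proof.
by move=> v; apply: (@continuous_sumr _ _ _ (fun k v => row_gaps v k)) => k;
  exact: continuous_row_gaps.
Qed.

Lemma continuous_pair_gaps_row m n (v : 'rV[R]_n) :
  (forall k, 0 < row_gaps v k) ->
  {for v, continuous (fun w => pair_gaps m n (row_gaps w))}.
Proof.
move=> v0; apply: (@continuous_sumr _ _ _ (fun (j : 'I_n.+1) w =>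
  \sum_(i < j) gapsum (row_gaps w) i j `^ (1 - m))) => j.
apply: (@continuous_sumr _ _ _ (fun (i : 'I_j) w =>
  gapsum (row_gaps w) i j `^ (1 - m))) => i.
apply: (@continuous_comp _ _ _ (fun w : 'rV[R]_n => gapsum (row_gaps w) i j)
  (fun y : R => y `^ (1 - m))).
  exact: continuous_gapsum_row.
exact/continuous_powR_gt0/gapsum_gt0.
Qed.

Lemma continuous_consec_gaps_row m n (v : 'rV[R]_n) :
  (forall k, 0 < row_gaps v k) ->
  {for v, continuous (fun w => consec_gaps m n (row_gaps w))}.
Proof.
move=> v0; apply: (@continuous_sumr _ _ _ (fun (i : 'I_n) w =>
  row_gaps w i `^ (1 - m))) => i.
apply: (@continuous_comp _ _ _ (fun w : 'rV[R]_n => row_gaps w i)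
  (fun y : R => y `^ (1 - m))).
  exact: continuous_row_gaps.
exact: continuous_powR_gt0.
Qed.

Lemma row_gaps_bounds n (M : R) (v : 'rV[R]_n) : 1 <= M ->
  (forall i, v ord0 i \in `[1, M]%R) -> forall k, 1 <= row_gaps v k <= M.
Proof.
move=> M1 v1 k; rewrite /row_gaps; case: insubP => [i _ _|_].
  by have := v1 i; rewrite in_itv.
by rewrite lexx.
Qed.

Lemma box_max m n (M : R) : (0 < n)%N -> 1 <= M ->
  exists g, (forall k, 1 <= g k <= M) /\
    forall e, (forall k, (k < n)%N -> 1 <= e k <= M) ->
      pair_gaps m n e / consec_gaps m n e <=
      pair_gaps m n g / consec_gaps m n g.
Proof.
move=> n0 M1.
pose A : set 'rV[R]_n := [set v | forall i, v ord0 i \in `[1, M]%R].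
pose f (v : 'rV[R]_n) :=
  pair_gaps m n (row_gaps v) / consec_gaps m n (row_gaps v).
have A0 : A !=set0.
  by exists (const_mx 1) => i; rewrite mxE in_itv/= lexx.
have cA : compact A.
  have := @rV_compact R n (fun=> `[1, M]%classic)
    (fun=> @segment_compact R 1 M).
  by congr (compact _); apply/seteqP; split => v /= vA i; exact: vA.
have cf : {within A, continuous f}.
  apply: continuous_in_subspaceT => v; rewrite inE => vA.
  have g0 k : 0 < row_gaps v k.
    by have /andP[+ _] := row_gaps_bounds M1 vA k; exact: lt_le_trans.
  apply: (continuousM (continuous_pair_gaps_row g0)).
  apply: (continuousV _ (continuous_consec_gaps_row g0)).
  by rewrite gt_eqF// consec_gaps_gt0.
have [v vA fv] := EVT_max_rV A0 cA cf.
rewrite inE in vA.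
exists (row_gaps v); split; first exact: row_gaps_bounds.
move=> e e1; have := fv (\row_(i < n) e i).
rewrite /f (eq_pair_gaps m (@row_gapsK n e)).
rewrite (eq_consec_gaps m (@row_gapsK n e)).
by apply; rewrite inE => i; rewrite mxE in_itv/= e1.
Qed.

(* A last gap [L] much longer than the others adds nearly [(n+1) L^(1-m)] to the
   pair sum, which beats [S L^(1-m)]. *)
Lemma far_point_increases m n (S : R) g : 1 < m -> 0 <= S <= n%:R ->
  (forall k, 0 < g k) -> pair_gaps m n g = S * consec_gaps m n g ->
  exists2 e, forall k, 0 < e k &
    S * consec_gaps m n.+1 e < pair_gaps m n.+1 e.
Proof.
move=> m1 /andP[S0 Sn] g0 gS.
pose T := gapsum g 0%N n.
have T0 : 0 <= T by apply: sumr_ge0 => k _; exact/ltW.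
pose L := 1 + n.+1%:R * ((m - 1) * T).
have mT0 : 0 <= n.+1%:R * ((m - 1) * T).
  by rewrite !mulr_ge0// subr_ge0 ltW.
have L0 : 0 < L by rewrite /L; lra.
pose e k := if (k < n)%N then g k else L.
have e0 k : 0 < e k by rewrite /e; case: ifP.
have eg k : (k < n)%N -> e k = g k by rewrite /e => ->.
exists e => //.
rewrite pair_gapsS consec_gapsS (eq_pair_gaps m eg) (eq_consec_gaps m eg) gS.
rewrite mulrDr ltrD2l.
have en : e n = L by rewrite /e ltnn.
(* All [n.+1] earlier points lie within [T + L] of the new one. *)
rewrite en; apply: (@lt_le_trans _ _ (n.+1%:R * (T + L) `^ (1 - m))); last first.
  rewrite mulr_natl -[X in _ *+ X](card_ord n.+1) -sumr_const.
  apply: ler_sum => i _; apply: gt0_ler_powR1B => //.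
    exact: gapsum_gt0.
  have in_ : (i <= n)%N by rewrite -ltnS.
  rewrite /gapsum big_nat_recr//= en lerD2r.
  rewrite -/(gapsum e i n) (eq_gapsum i eg (leqnn n)).
  rewrite /T -(gapsum_cat g (leq0n i) in_).
  by rewrite lerDr sumr_ge0// => k _; exact/ltW.
have -> : T + L = L * (1 + T / L) by field; rewrite gt_eqF.
have TL : 0 <= T / L by rewrite divr_ge0// ltW.
have u0 : 0 < 1 + T / L by lra.
rewrite powRM ?ltW// mulrCA [S * _]mulrC ltr_pM2l ?powR_gt0//.
apply: (le_lt_trans Sn).
apply: (@lt_le_trans _ _ (n.+1%:R * (m - (m - 1) * (1 + T / L)))); last first.
  by rewrite ler_pM2l// powR_tangent1.
have -> : n.+1%:R * (m - (m - 1) * (1 + T / L)) =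
    n%:R + (1 - (n.+1%:R * ((m - 1) * T)) / L).
  by rewrite mulrSr; field; rewrite gt_eqF.
by rewrite ltrDl subr_gt0 ltr_pdivrMr// mul1r /L ltrDr.
Qed.

(* A gap much larger than another one splits the configuration into two parts
   that interact weakly, so the ratio is controlled by fewer points. *)
Lemma pair_gaps_large_gap m n (S M : R) e k l : 1 < m -> 0 <= S -> 0 < M ->
  (forall j e, (j <= n)%N -> (forall k, 0 < e k) ->
     pair_gaps m j e <= S * consec_gaps m j e) ->
  (forall k, 0 < e k) -> (k <= n)%N -> (l <= n)%N -> M * e l <= e k ->
  pair_gaps m n.+1 e <=
  (S + n.+1%:R ^+ 2 * M `^ (1 - m)) * consec_gaps m n.+1 e.
Proof.
move=> m1 S0 M0 bound e0 kn ln Me.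
have [r nkr] : exists r, n = (k + r)%N by exists (n - k)%N; rewrite subnKC.
have rn : (r <= n)%N by rewrite nkr leq_addl.
have nE : n.+1 = (k.+1 + r)%N by rewrite nkr.
have ck0 := powR_ge0 (e k) (1 - m).
(* The cut term is small relative to the nearest-neighbour sum, which contains the term of the
   shorter gap [l]. *)
have ckM : e k `^ (1 - m) <= M `^ (1 - m) * consec_gaps m n.+1 e.
  apply: (@le_trans _ _ ((M * e l) `^ (1 - m))).
    by apply: gt0_ler_powR1B => //; rewrite mulr_gt0.
  rewrite powRM ?(ltW M0) ?(ltW (e0 l))// ler_pM2l ?powR_gt0//.
  rewrite /consec_gaps (bigD1 (Ordinal (ln : (l < n.+1)%N)))//= lerDl.
  by apply: sumr_ge0 => i _; exact: powR_ge0.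
have krN : k.+1%:R * r.+1%:R <= n.+1%:R ^+ 2 :> R.
  by rewrite expr2 -!natrM ler_nat leq_mul.
have := pair_gaps_split k r m1 e0.
rewrite -nE => /le_trans; apply.
rewrite mulrDl -[X in _ <= _ + X]mulrA; apply: lerD;
  last by rewrite ler_pM// mulr_ge0.
rewrite [in leRHS]nE consec_gaps_split mulrDr mulrDr.
have := bound k e kn e0.
have := bound r (fun i => e (k.+1 + i)%N) rn (fun i => e0 _).
have := mulr_ge0 S0 ck0.
lra.
Qed.

(** The induction carries [S <= n] for the remote point, and the bound for all [j <= n] because a
    cut yields two pieces of unknown smaller sizes. *)
Lemma exists_max_ratio m n : 1 < m -> exists (S : R) g,
  [/\ 0 <= S <= n%:R, forall k, 0 < g k,
    pair_gaps m n g = S * consec_gaps m n g &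
    forall j e, (j <= n)%N -> (forall k, 0 < e k) ->
      pair_gaps m j e <= S * consec_gaps m j e].
Proof.
move=> m1; elim: n => [|n [S [g [/andP[S0 Sn] g0 gS bound]]]].
  exists 0, (fun=> 1); split => //; first by rewrite lexx.
    by rewrite pair_gaps0 mul0r.
  by move=> j e; rewrite leqn0 => /eqP -> _; rewrite pair_gaps0 mul0r.
have S0n : 0 <= S <= n%:R by rewrite S0 Sn.
have [f f0 fS] := far_point_increases m1 S0n g0 gS.
have consec0 e : (forall k, 0 < e k) -> 0 < consec_gaps m n.+1 e.
  exact: consec_gaps_gt0.
pose S1 := pair_gaps m n.+1 f / consec_gaps m n.+1 f.
have SS1 : S < S1 by rewrite ltr_pdivlMr// consec0.
pose N : R := n.+1%:R ^+ 2.
have N0 : 0 < N by rewrite exprn_gt0.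
(* [M] is chosen with [M^(1-m) <= delta], so the error [N M^(1-m)] is at most half of [S1 - S]. *)
pose delta := (S1 - S) / N / 2.
have delta0 : 0 < delta by rewrite !divr_gt0// subr_gt0.
pose M := Num.max 1 (delta `^ (1 - m)^-1).
have M1 : 1 <= M by rewrite le_max lexx.
have M0 : 0 < M by exact: lt_le_trans M1.
have NM : S + N * M `^ (1 - m) < S1.
  rewrite -ltrBrDl mulrC -ltr_pdivlMr//.
  apply: (@le_lt_trans _ _ delta); last first.
    by rewrite ltr_pdivrMr// ltr_pMr ?divr_gt0 ?subr_gt0// ltr1n.
  apply: (@le_trans _ _ ((delta `^ (1 - m)^-1) `^ (1 - m))).
    by apply: gt0_ler_powR1B; rewrite ?powR_gt0// le_max lexx orbT.
  have m0 : 1 - m != 0 by rewrite lt_eqF// subr_lt0.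
  by rewrite -powRrM mulVf// powRr1// ltW.
have [h [h1 hmax]] := @box_max m n.+1 M isT M1.
have h0 k : 0 < h k.
  by have /andP[+ _] := h1 k; exact: lt_le_trans.
pose S2 := pair_gaps m n.+1 h / consec_gaps m n.+1 h.
(* Either some gap is at least [M] times another and the cut applies, or division by the smallest
   gap, which preserves the ratio, puts all gaps in [[1, M]]. *)
have dichotomy e : (forall k, 0 < e k) ->
    let r := pair_gaps m n.+1 e / consec_gaps m n.+1 e in r < S1 \/ r <= S2.
  move=> e0 r.
  have [/existsP[k /existsP[l lek]]|] :=
      boolP [exists k : 'I_n.+1, exists l : 'I_n.+1, M * e l <= e k].
    left; apply: le_lt_trans NM; rewrite /r ler_pdivrMr ?consec0//.
    by apply: (@pair_gaps_large_gap _ _ _ _ _ k l) => //; rewrite -ltnS ltn_ord.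
  rewrite negb_exists => /forallP eM; right.
  have [l _ minl] := @Order.TotalTheory.arg_minP _ _ _ (@ord0 n) xpredT
    (fun i => e i) isT.
  have el0 : 0 < (e l)^-1 by rewrite invr_gt0.
  have := hmax (fun k => (e l)^-1 * e k).
  rewrite pair_gapsZ// consec_gapsZ// -mulf_div divff ?mul1r; last first.
    by rewrite gt_eqF// powR_gt0.
  apply=> k kn; rewrite [_ * e k]mulrC ler_pdivlMr// mul1r ler_pdivrMr//.
  rewrite (minl (Ordinal kn) isT)/=.
  have := eM (Ordinal kn); rewrite negb_exists => /forallP/(_ l).
  by rewrite -ltNge => /ltW.
(* The ratio of [f] is [S1] itself, which excludes the first alternative. *)
have S12 : S1 <= S2.
  by have [|//] := dichotomy f f0; rewrite ltxx.
have S2bound e : (forall k, 0 < e k) ->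
    pair_gaps m n.+1 e <= S2 * consec_gaps m n.+1 e.
  move=> e0; rewrite -ler_pdivrMr ?consec0//.
  by have [/ltW/le_trans|] := dichotomy e e0; first exact.
have hS2 : pair_gaps m n.+1 h = S2 * consec_gaps m n.+1 h.
  by rewrite divfK// gt_eqF// consec0.
exists S2, h; split => //.
  rewrite (le_trans S0 (le_trans (ltW SS1) S12))/=.
  by rewrite ler_pdivrMr ?consec0// pair_gaps_le.
move=> j e; rewrite leq_eqVlt => /orP[/eqP ->|]; first exact: S2bound.
rewrite ltnS => jn e0; apply: (le_trans (bound j e jn e0)).
by rewrite ler_wpM2r ?consec_gaps_ge0// (le_trans (ltW SS1)).
Qed.

End Gaps.

Section Criticality.
Set Implicit Arguments. Unset Strict Implicit. Unset Printing Implicit Defensive.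
Context {R : realType}.
Implicit Types (m chi alpha : R) (n p : nat).

(** * First variation *)

Lemma is_derive_sumr (I : finType) (P : pred I) (f : I -> R -> R)
    (df : I -> R) (x : R) :
  (forall i, P i -> is_derive x (1 : R) (f i) (df i)) ->
  is_derive x (1 : R) (fun t => \sum_(i | P i) f i t) (\sum_(i | P i) df i).
Proof.
move=> fd; rewrite -[fun t => _]/(fun t => _) -fct_sumE.
by elim/big_ind2 : _ => // [|] *; [exact: is_derive_cst|exact: is_deriveD].
Qed.

Lemma is_derive_affine (c b x : R) :
  is_derive x (1 : R) (fun t => c + t * b) b.
Proof.
have -> : (fun t => c + t * b) = cst c + b *: (id : R -> R).
  by apply/funext => t /=; rewrite mulrC.
apply: (is_derive_eq (is_deriveD (is_derive_cst c x 1)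
  (is_deriveZ b (is_derive_id x 1)))).
by rewrite add0r scaler1.
Qed.

Lemma is_derive_powR_affine (a c b x : R) : 0 < c + x * b ->
  is_derive x (1 : R) (fun t => (c + t * b) `^ a)
    (a * (c + x * b) `^ (a - 1) * b).
Proof.
move=> cx0.
exact: (@is_derive1_comp R (fun y => y `^ a) (fun t => c + t * b) _ _ _
  (is_derive1_powR a cx0) (is_derive_affine c b x)).
Qed.

(** The affine function keeps its sign near [x], so the absolute value is locally affine. *)
Lemma is_derive_norm_powR_affine (a c b x : R) : c + x * b != 0 ->
  is_derive x (1 : R) (fun t => `|c + t * b| `^ a)
    (a * `|c + x * b| `^ (a - 1) * (Num.sg (c + x * b) * b)).
Proof.
have caff : {for x, continuous (fun t : R => c + t * b)}.
  by apply: differentiable_continuous; apply/derivable1_diffP;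
    have [] := is_derive_affine c b x.
rewrite neq_lt => /orP[cx0|cx0].
- rewrite ltr0_sg// ltr0_norm// mulN1r opprD -mulrN.
  apply: (@near_eq_is_derive _ _ _ (fun t : R => (- c + t * - b) `^ a));
    last first.
    by apply: is_derive_powR_affine; rewrite mulrN -opprD oppr_gt0.
  have : \forall t \near x, c + t * b < 0 by exact: (cvgr_lt _ caff).
  by apply: filterS => t t0; rewrite ltr0_norm// opprD mulrN.
- rewrite gtr0_sg// gtr0_norm// mul1r.
  apply: near_eq_is_derive; last exact: is_derive_powR_affine.
  have : \forall t \near x, 0 < c + t * b by exact: (cvgr_gt _ caff).
  by apply: filterS => t t0; rewrite gtr0_norm.
Qed.

(** The first variation of [consec_sum] along [h] without its factor [1 - m]; likewise [pair_var]
    for [pair_sum]. As [(1 - m) / (m - 1) = -1], both signs are reversed in [Fma_var]. *)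
Definition consec_var p m (V h : 'I_p -> R) :=
  \sum_(i < p) \sum_(j < p | val j == (val i).+1)
    (V j - V i) `^ (- m) * (h j - h i).

Definition pair_var p m (V h : 'I_p -> R) :=
  \sum_(i < p) \sum_(j < p | i != j)
    `|V i - V j| `^ (- m) * (Num.sg (V i - V j) * (h i - h j)).

Definition dot p (V h : 'I_p -> R) := \sum_(i < p) V i * h i.

Definition Fma_var p m chi alpha (V h : 'I_p -> R) :=
  chi * pair_var m V h - consec_var m V h + alpha * dot V h.

Definition increasing p (V : 'I_p -> R) :=
  forall i j : 'I_p, (i < j)%N -> V i < V j.

Lemma increasing_neq p (V : 'I_p -> R) (i j : 'I_p) :
  increasing V -> i != j -> V i - V j != 0.
Proof.
move=> Vinc; rewrite subr_eq0 -val_eqE neq_ltn => /orP[]/Vinc Vij.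
  by rewrite lt_eqF.
by rewrite gt_eqF.
Qed.

(** The derivative is taken at every [x] where the points stay ordered, since the interior minimum
    criterion in [minimizer_var] asks for derivability on an interval. *)
Lemma is_derive_Fma p m chi alpha (V h : 'I_p -> R) (x : R) : 1 < m ->
  increasing (fun k => V k + x * h k) ->
  is_derive x (1 : R) (fun t => Fma m chi alpha (fun k => V k + t * h k))
    (Fma_var m chi alpha (fun k => V k + x * h k) h).
Proof.
move=> m1 Vinc.
have m10 : m - 1 != 0 by rewrite subr_eq0 gt_eqF.
have diffE t i j :
    (V i + t * h i) - (V j + t * h j) = (V i - V j) + t * (h i - h j) by ring.
have mE : 1 - m - 1 = - m by ring.
have dconsec : is_derive x (1 : R)
    (fun t => consec_sum m (fun k => V k + t * h k))
    ((1 - m) * consec_var m (fun k => V k + x * h k) h).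
  rewrite /consec_var mulr_sumr; apply: is_derive_sumr => i _.
  rewrite mulr_sumr; apply: is_derive_sumr => j /eqP ij.
  under eq_fun do rewrite diffE.
  have Vij : 0 < V j - V i + x * (h j - h i).
    by rewrite -diffE subr_gt0 Vinc// ij.
  by have := is_derive_powR_affine (1 - m) Vij; rewrite mE diffE mulrA.
have dpair : is_derive x (1 : R)
    (fun t => pair_sum m (fun k => V k + t * h k))
    ((1 - m) * pair_var m (fun k => V k + x * h k) h).
  rewrite /pair_var mulr_sumr; apply: is_derive_sumr => i _.
  rewrite mulr_sumr; apply: is_derive_sumr => j ij.
  under eq_fun do rewrite diffE.
  have Vij : V i - V j + x * (h i - h j) != 0.
    by rewrite -diffE (increasing_neq Vinc).
  by have := is_derive_norm_powR_affine (1 - m) Vij; rewrite mE diffE -mulrA.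
have dnorm : is_derive x (1 : R)
    (fun t => sqnorm (fun k => V k + t * h k))
    (2 * dot (fun k => V k + x * h k) h).
  rewrite /dot mulr_sumr; apply: is_derive_sumr => i _.
  have -> : 2 * ((V i + x * h i) * h i) = (2%:R * (V i + x * h i) ^+ 1) *: h i.
    by rewrite expr1 mulrA.
  exact: (is_deriveX 2 (is_derive_affine (V i) (h i) x)).
have -> : (fun t => Fma m chi alpha (fun k => V k + t * h k)) =
    (m - 1)^-1 *: (fun t => consec_sum m (fun k => V k + t * h k))
    - (chi / (m - 1)) *: (fun t => pair_sum m (fun k => V k + t * h k))
    + (alpha / 2) *: (fun t => sqnorm (fun k => V k + t * h k)).
  by apply/funext => t; rewrite /Fma [alpha * _ / 2]mulrAC.
apply: (is_derive_eq (is_deriveD (is_deriveB (is_deriveZ _ dconsec)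
  (is_deriveZ _ dpair)) (is_deriveZ _ dnorm))).
by rewrite /Fma_var /GRing.scale/=; field.
Qed.

Lemma Fma_var_linear p m chi alpha (V : 'I_p -> R) (a : R) (h z : 'I_p -> R) :
  Fma_var m chi alpha V (fun k => a * h k + z k) =
  a * Fma_var m chi alpha V h + Fma_var m chi alpha V z.
Proof.
rewrite /Fma_var.
have -> : consec_var m V (fun k => a * h k + z k) =
    a * consec_var m V h + consec_var m V z.
  rewrite /consec_var mulr_sumr -big_split; apply: eq_bigr => i _ /=.
  rewrite mulr_sumr -big_split; apply: eq_bigr => j _ /=.
  by ring.
have -> : pair_var m V (fun k => a * h k + z k) =
    a * pair_var m V h + pair_var m V z.
  rewrite /pair_var mulr_sumr -big_split; apply: eq_bigr => i _ /=.
  rewrite mulr_sumr -big_split; apply: eq_bigr => j _ /=.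
  by ring.
have -> : dot V (fun k => a * h k + z k) = a * dot V h + dot V z.
  rewrite /dot mulr_sumr -big_split; apply: eq_bigr => i _ /=.
  by ring.
by ring.
Qed.

Lemma Fma_var0 p m chi alpha (V : 'I_p -> R) : Fma_var m chi alpha V 0 = 0.
Proof.
have := Fma_var_linear m chi alpha V (-1) 0 0; rewrite mulN1r addNr => <-.
by congr Fma_var; apply/funext => k; rewrite mulr0 addr0.
Qed.

Lemma sum_ebasis p (h : 'I_p -> R) : h = \sum_(i < p) h i *: ebasis i.
Proof.
apply/funext => j; rewrite fct_sumE (bigD1 j)//= big1 => [|i ij].
  by rewrite addr0 fctE /GRing.scale/= /ebasis eqxx mulr1.
by rewrite fctE /GRing.scale/= /ebasis eq_sym (negbTE ij) mulr0.
Qed.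

(** The partial derivatives give the basis directions; linearity of [Fma_var] in [h] gives the
    others. *)
Lemma critical_point_var p m chi alpha (V h : 'I_p -> R) : 1 < m ->
  critical_point (Fma m chi alpha) V -> Fma_var m chi alpha V h = 0.
Proof.
move=> m1 [[Vinc _] crit].
have var_ebasis i : Fma_var m chi alpha V (ebasis i) = 0.
  have V0 : (fun k => V k + 0 * ebasis i k) = V.
    by apply/funext => k; rewrite mul0r addr0.
  have Vinc0 : increasing (fun k => V k + 0 * ebasis i k) by rewrite V0.
  have [_ <-] := crit i.
  by have [_ ->] := is_derive_Fma chi alpha m1 Vinc0; rewrite V0.
rewrite (sum_ebasis h).
elim/big_rec : _ => [|i z _ z0]; first exact: Fma_var0.
apply: etrans (Fma_var_linear m chi alpha V (h i) (ebasis i) z) _.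
by rewrite var_ebasis z0 mulr0 addr0.
Qed.

Lemma near_increasing p (V h : 'I_p -> R) : increasing V ->
  \forall t \near (0 : R), increasing (fun k => V k + t * h k).
Proof.
move=> Vinc.
have : \forall t \near (0 : R), forall i j : 'I_p, (i < j)%N ->
    V i + t * h i < V j + t * h j.
  apply: (@filter_forall R 'I_p (fun i t => forall j : 'I_p, (i < j)%N ->
    V i + t * h i < V j + t * h j) (nbhs (0 : R)) _) => i.
  apply: (@filter_forall R 'I_p (fun j t => (i < j)%N ->
    V i + t * h i < V j + t * h j) (nbhs (0 : R)) _) => j.
  have [ij|_] := boolP (i < j)%N; last exact: nearW.
  have : {for (0 : R), continuous (fun t : R => (V j - V i) + t * (h j - h i))}.
    apply: differentiable_continuous; apply/derivable1_diffP.
    by have [] := is_derive_affine (V j - V i) (h j - h i) 0.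
  move=> /cvgr_gt /(_ 0); rewrite mul0r addr0 subr_gt0 => /(_ (Vinc _ _ ij)).
  by apply: filterS => t t0 _; rewrite -subr_gt0; lra.
by [].
Qed.

(** Minimality on [Rp] only tests directions of zero sum. A general [h] differs from one by a
    constant, along which the interaction terms are invariant and [dot V] vanishes because [V] is
    centred. *)
Lemma minimizer_var p m chi alpha (V h : 'I_p -> R) : 1 < m -> (0 < p)%N ->
  minimizer (Fma m chi alpha) V -> Fma_var m chi alpha V h = 0.
Proof.
move=> m1 p0 [[Vinc V0] Vmin].
have p0' : p%:R != 0 :> R by rewrite pnatr_eq0 -lt0n.
have centered (z : 'I_p -> R) : \sum_i z i = 0 -> Fma_var m chi alpha V z = 0.
  move=> z0.
  have /nbhs_ballP[r r0 rV] := near_increasing z Vinc.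
  have Vt t : t \in `](- r), r[%R -> increasing (fun k => V k + t * z k).
    rewrite in_itv/= => tr; apply: rV; rewrite /ball/= sub0r normrN.
    by rewrite ltr_norml.
  have itv0 : 0 \in `](- r), r[%R by rewrite in_itv/= oppr_lt0 r0.
  have Vx0 : (fun k => V k + 0 * z k) = V.
    by apply/funext => k; rewrite mul0r addr0.
  have [_ <-] : is_derive (0 : R) (1 : R)
      (fun t => Fma m chi alpha (fun k => V k + t * z k)) 0.
    apply: (@derive1_at_min _ _ (- r) r) => // [|t /Vt tV|t /Vt tV].
    - by rewrite ge0_cp// ltW.
    - by have [] := is_derive_Fma chi alpha m1 tV.
    - rewrite Vx0; apply: Vmin; split => //.
      by rewrite big_split/= -mulr_sumr V0 z0 mulr0 addr0.
  by have [_ ->] := is_derive_Fma chi alpha m1 (Vt 0 itv0); rewrite Vx0.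
pose c := (\sum_i h i) / p%:R.
have -> : h = (fun k => 1 * cst c k + (h k - c)).
  by apply/funext => k /=; rewrite mul1r addrC subrK.
rewrite Fma_var_linear mul1r (centered (fun k => h k - c)) ?addr0; last first.
  by rewrite sumrB sumr_const card_ord -mulr_natr divfK// subrr.
rewrite /Fma_var /consec_var /pair_var /dot -mulr_suml V0 mul0r mulr0 addr0.
rewrite !big1 ?mulr0 ?subr0// => i _; rewrite big1// => j _.
  by rewrite subrr mulr0.
by rewrite subrr !mulr0.
Qed.

(** For centred [V], the double sum of [(V_i - V_j)(z_i - z_j)] equals [2 p] times [dot V z], and
    each of its terms is nonnegative. *)
Lemma chebyshev_centered p (V z : 'I_p -> R) : \sum_i V i = 0 ->
  increasing V -> (forall i j : 'I_p, (i < j)%N -> z i <= z j) -> 0 <= dot V z.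
Proof.
move=> V0 Vinc zinc.
have [p0|p0] := posnP p.
  by rewrite /dot big1// => i; have := ltn_ord i; rewrite {2}p0.
have sq : 0 <= \sum_i \sum_j (V i - V j) * (z i - z j).
  apply: sumr_ge0 => i _; apply: sumr_ge0 => j _.
  have [ij|ij|/val_inj ->] := ltngtP i j; last by rewrite subrr mul0r.
    by rewrite -mulrNN !opprB mulr_ge0// subr_ge0 ?zinc// ltW ?Vinc.
  by rewrite mulr_ge0// subr_ge0 ?zinc// ltW ?Vinc.
have row i : \sum_j (V i - V j) * (z i - z j) =
    p%:R * (V i * z i) - V i * (\sum_j z j) + dot V z.
  have -> : \sum_j (V i - V j) * (z i - z j) =
      \sum_j (V i * z i - V i * z j + V j * z j - V j * z i).
    by apply: eq_bigr => j _; ring.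
  rewrite sumrB -mulr_suml V0 mul0r subr0 big_split sumrB/=.
  by rewrite sumr_const card_ord -mulr_sumr mulr_natl.
move: sq; under eq_bigr do rewrite row.
rewrite big_split sumrB/= -mulr_sumr -mulr_suml V0 mul0r subr0 sumr_const.
rewrite card_ord -/(dot V z) -[dot V z *+ p]mulr_natl -mulrDr.
by rewrite pmulr_rge0 ?ltr0n//; lra.
Qed.

(** * Dictionary between points and gaps *)

(** The default 1 past the last gap provides positivity at every index, as the lemmas on gaps
    require. *)
Definition gaps_of n (X : 'I_n.+1 -> R) : nat -> R :=
  fun k => if (k < n)%N then X (inord k.+1) - X (inord k) else 1.

Lemma gaps_of_gt0 n (X : 'I_n.+1 -> R) k : increasing X -> 0 < gaps_of X k.
Proof.
move=> Xinc; rewrite /gaps_of; case: ifP => // kn.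
by rewrite subr_gt0 Xinc// !inordK// ltnW.
Qed.

Lemma gapsum_gaps_of n (X : 'I_n.+1 -> R) (i j : 'I_n.+1) : (i <= j)%N ->
  gapsum (gaps_of X) i j = X j - X i.
Proof.
move=> ij; rewrite -[in RHS](inord_val j) -[in RHS](inord_val i).
rewrite -(telescope_sumr (fun k => X (inord k)) ij).
rewrite /gapsum !big_nat; apply: eq_bigr => k /andP[_ kj].
by rewrite /gaps_of (leq_trans kj) // -ltnS.
Qed.

Lemma sum_consec n (F : 'I_n.+1 -> 'I_n.+1 -> R) :
  \sum_i \sum_(j | val j == (val i).+1) F i j =
  \sum_(k < n) F (inord k) (inord k.+1).
Proof.
(* The last point has no successor. *)
rewrite big_ord_recr/= [X in _ + X]big_pred0 ?addr0; last first.
  by move=> j; rewrite ltn_eqF.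
apply: eq_bigr => k _; rewrite (big_pred1 (inord k.+1)) => [|j].
  by congr F; apply/val_inj; rewrite /= inordK// ltnW// ltnS.
by rewrite /= -val_eqE/= inordK// ltnS.
Qed.

Lemma sum_pairs n (F : 'I_n.+1 -> 'I_n.+1 -> R) :
  (forall i j, F i j = F j i) ->
  \sum_i \sum_(j | i != j) F i j =
  2 * \sum_(j < n.+1) \sum_(i < j) F (inord i) j.
Proof.
move=> Fsym.
have lower (j : 'I_n.+1) :
    \sum_(i < j) F (inord i) j = \sum_(i < n.+1 | (i < j)%N) F i j.
  rewrite (big_ord_widen n.+1 (fun i => F (inord i) j)) ?(ltnW (ltn_ord j))//.
  by apply: eq_bigr => i _; rewrite inord_val.
have -> : \sum_i \sum_(j | i != j) F i j =
    \sum_(i < n.+1) \sum_(j < n.+1 | (i < j)%N) F i j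
    + \sum_(i < n.+1) \sum_(j < n.+1 | (j < i)%N) F i j.
  rewrite -big_split; apply: eq_bigr => i _ /=.
  rewrite (bigID (fun j : 'I_n.+1 => (i < j)%N))/=.
  congr (_ + _); apply: eq_bigl => j.
    by rewrite -val_eqE/=; case: ltngtP.
  by rewrite -val_eqE/=; case: ltngtP.
rewrite (exchange_big_dep xpredT)//= mulr_natl mulr2n.
by congr (_ + _); apply: eq_bigr => i _; rewrite lower//; apply: eq_bigr => j _.
Qed.

(** Any [g] with the right partial sums is allowed: it is [gaps_of X] for a given point, and the
    maximizing gaps when the point is built from them. *)
Lemma consec_sum_gaps n (X : 'I_n.+1 -> R) (g : nat -> R) m :
  (forall i j : 'I_n.+1, (i <= j)%N -> gapsum g i j = X j - X i) ->
  consec_sum m X = consec_gaps m n g.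
Proof.
move=> gX; rewrite /consec_sum sum_consec; apply: eq_bigr => k _.
by rewrite -gX !inordK// ?ltnS ?(ltnW (ltn_ord k))// /gapsum big_nat1.
Qed.

Lemma pair_sum_gaps n (X : 'I_n.+1 -> R) (g : nat -> R) m :
  (forall k, 0 < g k) ->
  (forall i j : 'I_n.+1, (i <= j)%N -> gapsum g i j = X j - X i) ->
  pair_sum m X = 2 * pair_gaps m n g.
Proof.
move=> g0 gX; rewrite /pair_sum sum_pairs => [|i j]; last by rewrite distrC.
congr (_ * _); apply: eq_bigr => j _; apply: eq_bigr => i _.
have ij : (i < n.+1)%N := ltn_trans (ltn_ord i) (ltn_ord j).
by rewrite distrC -gX inordK// ?(ltnW (ltn_ord i))// gtr0_norm// gapsum_gt0.
Qed.

(** * Comparison with a competitor *)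

Lemma powRN_mul m (x : R) : 0 < x -> x `^ (- m) * x = x `^ (1 - m).
Proof.
move=> x0; rewrite -[X in _ * X]powRr1 ?ltW// -powRD; first by rewrite addrC.
by rewrite (gt_eqF x0) implybT.
Qed.

(** Euler's identity for homogeneous functions, up to the omitted factor [1 - m]. *)
Lemma consec_var_self p m (V : 'I_p -> R) : increasing V ->
  consec_var m V V = consec_sum m V.
Proof.
move=> Vinc; apply: eq_bigr => i _; apply: eq_bigr => j /eqP ij.
by rewrite powRN_mul// subr_gt0 Vinc// ij.
Qed.

Lemma pair_var_self p m (V : 'I_p -> R) : increasing V ->
  pair_var m V V = pair_sum m V.
Proof.
move=> Vinc; apply: eq_bigr => i _; apply: eq_bigr => j ij.
have Vij := increasing_neq Vinc ij.
by rewrite -normrEsg powRN_mul// normr_gt0.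
Qed.

Lemma dot_self p (V : 'I_p -> R) : dot V V = sqnorm V.
Proof. by apply: eq_bigr => i _; rewrite expr2. Qed.

(** The direction starts at 0 and is not centred, hence the interest of a first variation that
    vanishes along all directions. *)
Definition test_variation n m (V X : 'I_n.+1 -> R) : 'I_n.+1 -> R :=
  fun j => gapsum (test_gaps m (gaps_of V) (gaps_of X)) 0%N j.

Lemma test_variationB n m (V X : 'I_n.+1 -> R) (i j : 'I_n.+1) : (i <= j)%N ->
  test_variation m V X j - test_variation m V X i =
  gapsum (test_gaps m (gaps_of V) (gaps_of X)) i j.
Proof.
by move=> ij; rewrite /test_variation -(gapsum_cat _ (leq0n i) ij) addrC addKr.
Qed.

(** On each gap, [d^(-m) d (e/d)^(1-m) = e^(1-m)]; this dictates the form of [test_gaps]. *)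
Lemma consec_var_test n m (V X : 'I_n.+1 -> R) : increasing V -> increasing X ->
  consec_var m V (test_variation m V X) = consec_sum m X.
Proof.
move=> Vinc Xinc; apply: eq_bigr => i _; apply: eq_bigr => j /eqP/= ij.
have ij' : (i <= j)%N by rewrite ij.
rewrite test_variationB// -!gapsum_gaps_of// ij /gapsum !big_nat1 /test_gaps.
have d0 := gaps_of_gt0 i Vinc; have e0 := gaps_of_gt0 i Xinc.
rewrite mulrA powRN_mul// -powRM ?ltW ?divr_gt0// mulrCA divff ?mulr1//.
by rewrite gt_eqF.
Qed.

(** Jensen's inequality between points [i] and [j], multiplied by [(V_j - V_i)^(-m)]. *)
Lemma pair_var_test_term n m (V X : 'I_n.+1 -> R) (i j : 'I_n.+1) : 1 < m ->
  increasing V -> increasing X -> (i < j)%N ->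
  let h := test_variation m V X in
  `|X i - X j| `^ (1 - m) <=
    `|V i - V j| `^ (- m) * (Num.sg (V i - V j) * (h i - h j))
    ?= iff [forall k : 'I_j, (i <= k)%N ==>
             (gaps_of X k == (X j - X i) / (V j - V i) * gaps_of V k)].
Proof.
move=> m1 Vinc Xinc ij h.
have D0 : 0 < V j - V i by rewrite subr_gt0 Vinc.
have E0 : 0 < X j - X i by rewrite subr_gt0 Xinc.
rewrite distrC [`|V i - V j|]distrC !gtr0_norm//.
rewrite -[V i - V j]opprB sgrN gtr0_sg// mulN1r opprB.
rewrite test_variationB ?(ltnW ij)//.
rewrite -!gapsum_gaps_of ?(ltnW ij)// in D0 E0 *.
have J := gapsum_test_gaps m1 (fun k => gaps_of_gt0 k Vinc)
  (fun k => gaps_of_gt0 k Xinc) ij.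
have Dm : 0 < gapsum (gaps_of V) i j `^ (- m) by rewrite powR_gt0.
have -> : gapsum (gaps_of X) i j `^ (1 - m) = gapsum (gaps_of V) i j `^ (- m) *
    (gapsum (gaps_of V) i j `^ m * gapsum (gaps_of X) i j `^ (1 - m)).
  by rewrite mulrA powRN mulVf ?mul1r// gt_eqF// powR_gt0.
by split; rewrite ?ler_pM2l ?(inj_eq (mulfI (lt0r_neq0 Dm))); case: J.
Qed.

(** Exchanging [i] and [j] flips both the sign and the difference, so the case [i < j] suffices.
    Equality is recorded term by term, to be read later on a single pair. *)
Lemma pair_var_test n m (V X : 'I_n.+1 -> R) : 1 < m ->
  increasing V -> increasing X ->
  pair_sum m X <= pair_var m V (test_variation m V X)
    ?= iff [forall i, forall (j | i != j),
      `|X i - X j| `^ (1 - m) == `|V i - V j| `^ (- m) * (Num.sg (V i - V j) *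
        (test_variation m V X i - test_variation m V X j))].
Proof.
move=> m1 Vinc Xinc; apply: leif_sum => i _; apply: leif_sum => j ij.
apply: leif_eq; move: ij; rewrite -val_eqE neq_ltn => /orP[ij|ji].
  by have [] := pair_var_test_term m1 Vinc Xinc ij.
have [+ _] := pair_var_test_term m1 Vinc Xinc ji.
rewrite distrC [`|V j - V i|]distrC -[V j - V i]opprB sgrN mulNr -mulrN opprB.
by [].
Qed.

(** The tangent at ratio 1 says that [h - (m V - (m-1) X)] is nondecreasing, where [h] is the test
    direction; Chebyshev's inequality then applies to it. *)
Lemma dot_test_ge n m (V X : 'I_n.+1 -> R) : 1 < m ->
  \sum_i V i = 0 -> increasing V -> increasing X ->
  m * sqnorm V - (m - 1) * dot V X <= dot V (test_variation m V X).
Proof.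
move=> m1 V0 Vinc Xinc.
pose z i := test_variation m V X i - (m * V i - (m - 1) * X i).
have : 0 <= dot V z.
  apply: chebyshev_centered => // i j ij; rewrite -subr_ge0.
  have -> : z j - z i = (test_variation m V X j - test_variation m V X i)
      - (m * (V j - V i) - (m - 1) * (X j - X i)) by rewrite /z; ring.
  rewrite test_variationB ?(ltnW ij)// -!gapsum_gaps_of ?(ltnW ij)//.
  rewrite -!gapsumZ /gapsum -!sumrB sumr_ge0// => k _; rewrite subr_ge0.
  have [+ _] := test_gaps_tangent m1 (@ltr01 R) (gaps_of_gt0 k Vinc)
    (gaps_of_gt0 k Xinc).
  by rewrite powR1 mul1r divr1.
have -> : dot V z =
    dot V (test_variation m V X) - (m * sqnorm V - (m - 1) * dot V X).
  rewrite /sqnorm /dot !mulr_sumr -!sumrB; apply: eq_bigr => i _.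
  by rewrite /z; ring.
by rewrite subr_ge0.
Qed.

(** Testing against [V] gives [consec_sum - chi pair_sum = alpha |V|^2] at [V]; testing against
    [test_variation] bounds the same quantity at [X] below by [alpha (m |V|^2 - (m-1) V.X)]. The
    difference of energies is thus at least [alpha |X - V|^2 / 2]. *)
Lemma Fma_le n m chi alpha (V X : 'I_n.+1 -> R) :
  1 < m -> 0 < chi -> 0 <= alpha ->
  (forall h, Fma_var m chi alpha V h = 0) -> Rp V -> Rp X ->
  Fma m chi alpha V <= Fma m chi alpha X.
Proof.
move=> m1 chi0 alpha0 crit [Vinc V0] [Xinc X0].
have m10 : 0 < m - 1 by rewrite subr_gt0.
have := crit V.
rewrite /Fma_var consec_var_self// pair_var_self// dot_self => eqV.
have := crit (test_variation m V X); rewrite /Fma_var consec_var_test// => eqX.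
have [leP _] := pair_var_test m1 Vinc Xinc.
have leD := dot_test_ge m1 V0 Vinc Xinc.
have sq : 0 <= sqnorm X - 2 * dot V X + sqnorm V.
  have -> : sqnorm X - 2 * dot V X + sqnorm V = \sum_i (X i - V i) ^+ 2.
    rewrite /sqnorm /dot mulr_sumr -sumrB -big_split; apply: eq_bigr => i _ /=.
    by ring.
  by apply: sumr_ge0 => i _; exact: sqr_ge0.
have FE Y : (m - 1) * Fma m chi alpha Y = consec_sum m Y - chi * pair_sum m Y
    + (m - 1) * (alpha * sqnorm Y / 2).
  by rewrite /Fma; field; rewrite gt_eqF.
rewrite -(ler_pM2l m10) !FE.
have leP' := ler_wpM2l (ltW chi0) leP.
have leD' := ler_wpM2l alpha0 leD.
have sq' := mulr_ge0 (ltW m10) (mulr_ge0 alpha0 sq).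
lra.
Qed.

(** Testing [X] against itself and [V] against the test direction yields [consec_sum m X] both
    times, so [pair_var_test] is an equality. *)
Lemma Fm_minimizers_proportional n m chi (V X : 'I_n.+1 -> R) :
  1 < m -> 0 < chi ->
  (0 < n)%N -> minimizer (Fm m chi) V -> minimizer (Fm m chi) X ->
  exists lambda, 0 < lambda /\ X = (fun k => lambda * V k).
Proof.
move=> m1 chi0 n0 Vmin Xmin.
have crit (Y h : 'I_n.+1 -> R) :
    minimizer (Fm m chi) Y -> Fma_var m chi 0 Y h = 0.
  by move=> Ymin; exact: (@minimizer_var _ m chi 0 Y h m1 (ltn0Sn n) Ymin).
have [[Vinc V0] _] := Vmin; have [[Xinc X0] _] := Xmin.
have := crit X X Xmin.
rewrite /Fma_var consec_var_self// pair_var_self// mul0r addr0 => eqX.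
have := crit V (test_variation m V X) Vmin.
rewrite /Fma_var consec_var_test// mul0r addr0 => eqV.
have [_] := pair_var_test m1 Vinc Xinc.
have -> : pair_sum m X = pair_var m V (test_variation m V X).
  by apply: (mulfI (lt0r_neq0 chi0)); lra.
(* The pair of the first and last points spans all gaps, so its equality case alone fixes every
   ratio. *)
rewrite eqxx => /esym/forallP/(_ ord0)/forall_inP/(_ ord_max).
rewrite -val_eqE/= eq_sym -lt0n => /(_ n0) eq0.
have [_] :=
  @pair_var_test_term _ _ _ _ (ord0 : 'I_n.+1) ord_max m1 Vinc Xinc n0.
rewrite eq0 => /esym/forallP/= prop.
set s := (X ord_max - X ord0) / (V ord_max - V ord0) in prop.
have s0 : 0 < s by rewrite divr_gt0// subr_gt0 ?Vinc ?Xinc.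
exists s; split => //.
have XV (j : 'I_n.+1) : X j = s * V j + (X ord0 - s * V ord0).
  suff : X j - X ord0 = s * (V j - V ord0) by lra.
  rewrite -!gapsum_gaps_of// -gapsumZ /gapsum !big_nat.
  apply: eq_bigr => k /= kj.
  have kn : (k < n)%N by rewrite (leq_trans kj)// -ltnS.
  by have /eqP := prop (Ordinal kn).
(* Both points being centred, the remaining translation vanishes. *)
have : \sum_i X i = s * (\sum_i V i) + n.+1%:R * (X ord0 - s * V ord0).
  rewrite mulr_sumr mulr_natl -[X in _ *+ X](card_ord n.+1) -sumr_const.
  by rewrite -big_split; apply: eq_bigr => i _; exact: XV.
rewrite X0 V0 mulr0 add0r => /esym/eqP; rewrite mulf_eq0 pnatr_eq0/= => /eqP c0.
by apply/funext => j; rewrite XV c0 addr0.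
Qed.

Lemma Fm_minimizer_exists n m chi : 1 < m -> 0 < chi -> (0 < n)%N ->
  chi = Cp n.+1 m -> exists V : 'I_n.+1 -> R, minimizer (Fm m chi) V.
Proof.
move=> m1 chi0 n0 chiE.
have [S [g [_ g0 gS bound]]] := exists_max_ratio n m1.
(* Subtracting the mean centres the configuration with maximizing gaps. *)
pose c : R := (\sum_(j < n.+1) gapsum g 0%N j) / n.+1%:R.
pose V (j : 'I_n.+1) := gapsum g 0%N j - c.
have gV (i j : 'I_n.+1) : (i <= j)%N -> gapsum g i j = V j - V i.
  move=> ij; rewrite /V -(gapsum_cat g (leq0n i) ij).
  by ring.
have RpV : Rp V.
  split=> [i j ij|]; first by rewrite -subr_gt0 -gV ?(ltnW ij)// gapsum_gt0.
  by rewrite sumrB sumr_const card_ord -mulr_natr divfK ?subrr// pnatr_eq0.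
have pairS (X : 'I_n.+1 -> R) : Rp X -> pair_sum m X <= 2 * S * consec_sum m X.
  move=> [Xinc _]; have X0 k := gaps_of_gt0 k Xinc.
  rewrite (consec_sum_gaps m (@gapsum_gaps_of _ X)).
  rewrite (pair_sum_gaps m X0 (@gapsum_gaps_of _ X)).
  by rewrite -mulrA ler_pM2l// bound.
have pairV : pair_sum m V = 2 * S * consec_sum m V.
  by rewrite (consec_sum_gaps m gV) (pair_sum_gaps m g0 gV) gS mulrA.
have consec0 (X : 'I_n.+1 -> R) : Rp X -> 0 < consec_sum m X.
  move=> [Xinc _]; have X0 k := gaps_of_gt0 k Xinc.
  by rewrite (consec_sum_gaps m (@gapsum_gaps_of _ X)) consec_gaps_gt0.
(* The factor 2 appears because [pair_sum] counts ordered pairs; the supremum is attained at [V]. *)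
have CpE : Cp n.+1 m = (2 * S)^-1.
  rewrite /Cp; congr (_^-1); set A := (X in sup X).
  have ubA : ubound A (2 * S).
    by move=> _ [X RpX <-]; rewrite ler_pdivrMr ?consec0// pairS.
  have AS : A (2 * S).
    by exists V => //; rewrite pairV mulfK// gt_eqF// consec0.
  apply/eqP; rewrite eq_le; apply/andP; split.
    by apply: ge_sup => //; exists (2 * S).
  by apply: ub_le_sup => //; exists (2 * S).
have S0 : 0 < 2 * S by rewrite -invr_gt0 -CpE -chiE.
have FE (X : 'I_n.+1 -> R) :
    Fm m chi X = (m - 1)^-1 * (consec_sum m X - chi * pair_sum m X).
  by rewrite /Fm /Fma; ring.
exists V; split => // X RpX.
(* At this [chi] the energy of [V] is 0, and [pairS] makes every other energy nonnegative. *)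
rewrite !FE pairV chiE CpE mulrA mulVf ?gt_eqF// mul1r subrr mulr0.
rewrite mulr_ge0 ?invr_ge0 ?subr_ge0 ?(ltW m1)//.
by rewrite mulrC ler_pdivrMr// mulrC pairS.
Qed.

End Criticality.

Theorem theorem3p1 (R : realType) (m chi : R) (p : nat) :
  1 < m -> 0 < chi -> (2 <= p)%N ->
  (forall (alpha : R) (X : 'I_p -> R), 0 <= alpha ->
     critical_point (Fma m chi alpha) X -> minimizer (Fma m chi alpha) X) /\
  (chi = Cp p m ->
     (exists V : 'I_p -> R, minimizer (Fm m chi) V) /\
     (forall V V' : 'I_p -> R, minimizer (Fm m chi) V -> minimizer (Fm m chi) V' ->
        exists lambda : R, 0 < lambda /\ V' = (fun k => lambda * V k))).
Proof.
(* From here [n] counts the gaps, and [2 <= p] becomes [0 < n]. *)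
case: p => // n m1 chi0; rewrite ltnS => n0; split=> [alpha X alpha0 crit|chiE].
  have [RpX _] := crit; split => // Y RpY; apply: Fma_le => // h.
  exact: critical_point_var.
split; first exact: Fm_minimizer_exists.
by move=> V V'; exact: Fm_minimizers_proportional.
Qed.
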